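(* Assume $m(0)>0$, $|\mathbb{P}(0)|>0$, and that the parameters $(\gamma,\mu,\lambda,\kappa)$ satisfy $$\gamma\ge1,\quad \mu\ge0,\quad 2\mu+3\lambda\ge0,\quad \kappa\ge0.$$ Then for the Cauchy problem (FP) there is no classical solution $(\rho,u,S)\in D(\infty)$ with $$\limsup_{t\to\infty}|u(t,\cdot)|_{L^\infty(\mathbb{R}^3)}=0.$$
   Context: The Cauchy problem (FP): the full compressible Navier-Stokes system in $\mathbb{R}^3$ $$\begin{cases}\rho_t+\mathrm{div}(\rho u)=0,\\ (\rho u)_t+\mathrm{div}(\rho u\otimes u)+\nabla P=\mathrm{div}\mathbb{T},\\ (\rho\mathcal{E})_t+\mathrm{div}(\rho\mathcal{E}u+Pu)=\mathrm{div}(u\mathbb{T})+\mathrm{div}(\kappa\nabla\theta),\end{cases}$$ where $\rho\ge0$ is the density, $u\in\mathbb{R}^3$ the velocity, $\theta$ the absolute temperature, $S$ the entropy, $\mathcal{E}=e+\frac12|u|^2$, $e$ the specific internal energy, with the polytropic equation of state $P=R\rho\theta=(\gamma-1)\rho e=Ae^{S/c_v}\rho^\gamma$, $e=c_v\theta$, $c_v=R/(\gamma-1)$ ($A,R>0$ constants), and $\mathbb{T}=\mu(\nabla u+(\nabla u)^\top)+\lambda\,\mathrm{div}u\,\mathbb{I}_3$, where $\mu$ is the shear viscosity coefficient, $\lambda+\frac23\mu$ the bulk viscosity coefficient and $\kappa$ the thermal conductivity coefficient. Initial data: $(\rho,u,S)|_{t=0}=(\rho_0,u_0,S_0)$ on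 $\mathbb{R}^3$ with $\rho_0>0$; far field behavior: $(\rho,u,S)(t,x)\to(0,0,\bar S)$ as $|x|\to\infty$ for $t\ge0$, with $\bar S$ a constant. Quantities: $m(t)=\int_{\mathbb{R}^3}\rho(t,\cdot)\,dx$, $\mathbb{P}(t)=\int_{\mathbb{R}^3}\rho(t,\cdot)u(t,\cdot)\,dx$, $E_k(t)=\frac12\int_{\mathbb{R}^3}\rho(t,\cdot)|u(t,\cdot)|^2dx$. Solution class: for $T>0$, a classical solution $(\rho,u,S)$ of (FP) is in $D(T)$ if $m(t)$, $\mathbb{P}(t)$, $E_k(t)$ all belong to $L^\infty([0,T])$, $\frac{d}{dt}m(t)=0$ for all $t\in[0,T]$ (conservation of total mass), and $\frac{d}{dt}\mathbb{P}(t)=0$ for all $t\in[0,T]$ (conservation of momentum). $(\rho,u,S)\in D(\infty)$ means that the classical solution is defined for all $t\geq 0$ and belongs to $D(T)$ for every finite $T>0$. *)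

(* Defs.v *)
From HB Require Import structures.
From mathcomp Require Import all_boot all_order all_algebra.
From mathcomp Require Import all_classical all_reals all_analysis.
From mathcomp Require Import measurable_realfun ess_sup_inf.

Set Implicit Arguments.
Unset Strict Implicit.
Unset Printing Implicit Defensive.

Import Order.TTheory GRing.Theory Num.Theory.
Import numFieldNormedType.Exports.

Local Open Scope classical_set_scope.
Local Open Scope ring_scope.

Notation vec3 R := 'rV[R]_3.

Definition enorm (R : realType) (v : vec3 R) : R :=
  Num.sqrt (\sum_(i < 3) v ord0 i ^+ 2).

(* The library has no measure on 'rV[R]_3: functions on vec3 R are integrated
   by pulling them back along the coordinate map [point3] to R * R * R with
   the product Lebesgue measure [leb3]. *)
Definition point3 (R : realType)
    (p : measurableTypeR R * measurableTypeR R * measurableTypeR R) : vec3 R :=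
  \row_(i < 3) nth 0 [:: p.1.1; p.1.2; p.2] i.

Definition leb3 (R : realType) :=
  ((@lebesgue_measure R \x @lebesgue_measure R) \x @lebesgue_measure R)%E.

Definition integral3 (R : realType) (f : vec3 R -> R) : \bar R :=
  (\int[@leb3 R]_p (f (point3 p))%:E)%E.

(* The L^oo(R^3) norm of the pointwise Euclidean norm of a vector field. *)
Definition Linfty_norm3 (R : realType) (v : vec3 R -> vec3 R) : \bar R :=
  Lnorm (@leb3 R) +oo%E (fun p => (enorm (v (point3 p)))%:E).

Definition in_Linfty (R : realType) (T : R) (f : R -> \bar R) : Prop :=
  measurable_fun `[0, T] f /\
  (Lnorm (@lebesgue_measure R) +oo (f \_ `[0%R, T]) < +oo)%E.

(* The time derivative relative to [0, T]: one-sided at the end points. *)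
Definition is_deriv_within (R : realType) (T : R) (f : R -> R) (t l : R) : Prop :=
  (fun s => (f s - f t) / (s - t)) @ within `[0, T] t^' --> l.

Definition conserved (R : realType) (T : R) (f : R -> \bar R) : Prop :=
  forall t, 0 <= t <= T ->
    f t \is a fin_num /\ is_deriv_within T (fun s => fine (f s)) t 0.

Definition tends_at_infinity (R : realType) (f : vec3 R -> R) (l : R) : Prop :=
  forall e : R, 0 < e ->
    exists M : R, forall x : vec3 R, M < enorm x -> `|f x - l| < e.

Definition dt (R : realType) (f : R -> vec3 R -> R) (t : R) (x : vec3 R) : R :=
  derive1 (fun s : R => f s x) t.

Definition dx (R : realType) (i : 'I_3) (f : R -> vec3 R -> R)
    (t : R) (x : vec3 R) : R :=
  'D_(delta_mx ord0 i) (f t) x.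

Definition has_cont_dt (R : realType) (T : R) (f : R -> vec3 R -> R) : Prop :=
  forall t x, 0 < t < T ->
    derivable (fun s : R => f s x) t 1 /\
    {for (t, x), continuous (fun p : R * vec3 R => dt f p.1 p.2)}.

Definition has_cont_dx (R : realType) (T : R) (i : 'I_3)
    (f : R -> vec3 R -> R) : Prop :=
  forall t x, 0 < t < T ->
    derivable (f t) x (delta_mx ord0 i) /\
    {for (t, x), continuous (fun p : R * vec3 R => dx i f p.1 p.2)}.

(* f is of class C^1 on ]0, T[ x R^3 (all partials exist and are continuous). *)
Definition C1 (R : realType) (T : R) (f : R -> vec3 R -> R) : Prop :=
  has_cont_dt T f /\ forall i, has_cont_dx T i f.

Definition C0 (R : realType) (T : R) (f : R -> vec3 R -> R) : Prop :=
  {within `[0, T] `*` [set: vec3 R],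
    continuous (fun p : R * vec3 R => f p.1 p.2)}.

(* The transport coefficients may depend on the thermodynamic state (density,
   temperature); constant coefficients are the constant functions. *)
Record gas (R : realType) := Gas {
  gasA : R;
  gasR : R;
  gamma : R;
  mu : R -> R -> R;
  lambda : R -> R -> R;
  kappa : R -> R -> R }.

Section State.
Variables (R : realType) (g : gas R).
Variables (rho : R -> vec3 R -> R) (u : R -> vec3 R -> vec3 R).
Variable s : R -> vec3 R -> R.

(* When gamma = 1, c_v is infinite in the physical model; here c_v = 0 and
   S / c_v = 0 by the convention x / 0 = 0, so that P = A rho and
   theta = A / gasR, which are the values of the limit gamma -> 1. *)
Definition c_v : R := gasR g / (gamma g - 1).

Definition vel (i : 'I_3) (t : R) (x : vec3 R) : R := u t x ord0 i.

Definition pressure (t : R) (x : vec3 R) : R :=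
  gasA g * expR (s t x / c_v) * rho t x `^ gamma g.

(* The solution theta of P = gasR * rho * theta, with the common factor rho
   cancelled. *)
Definition temperature (t : R) (x : vec3 R) : R :=
  gasA g / gasR g * expR (s t x / c_v) * rho t x `^ (gamma g - 1).

Definition internal_energy (t : R) (x : vec3 R) : R := c_v * temperature t x.

Definition total_energy (t : R) (x : vec3 R) : R :=
  internal_energy t x + enorm (u t x) ^+ 2 / 2.

Definition div_vel (t : R) (x : vec3 R) : R := \sum_(k < 3) dx k (vel k) t x.

Definition stress (i j : 'I_3) (t : R) (x : vec3 R) : R :=
  mu g (rho t x) (temperature t x) * (dx j (vel i) t x + dx i (vel j) t x)
  + lambda g (rho t x) (temperature t x) * div_vel t x * (i == j)%:R.

Definition heat_flux (j : 'I_3) (t : R) (x : vec3 R) : R :=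
  kappa g (rho t x) (temperature t x) * dx j temperature t x.

Definition mass_eq (t : R) (x : vec3 R) : Prop :=
  dt rho t x + \sum_(j < 3) dx j (fun t x => rho t x * vel j t x) t x = 0.

Definition momentum_eq (t : R) (x : vec3 R) : Prop :=
  forall i : 'I_3,
    dt (fun t x => rho t x * vel i t x) t x
    + \sum_(j < 3) dx j (fun t x => rho t x * vel i t x * vel j t x) t x
    + dx i pressure t x
    = \sum_(j < 3) dx j (stress i j) t x.

Definition energy_eq (t : R) (x : vec3 R) : Prop :=
  dt (fun t x => rho t x * total_energy t x) t x
  + \sum_(j < 3) dx j (fun t x => rho t x * total_energy t x * vel j t x
                                  + pressure t x * vel j t x) t x
  = \sum_(j < 3) dx j (fun t x => \sum_(i < 3) vel i t x * stress i j t x) t x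
  + \sum_(j < 3) dx j (heat_flux j) t x.

(* Classical regularity: every derivative occurring in the system exists and is
   continuous for 0 < t < T, and the unknowns are continuous up to t = 0. *)
Definition classical_regularity (T : R) : Prop :=
  [/\ C0 T rho /\ C1 T rho,
      forall i, C0 T (vel i) /\ C1 T (vel i),
      C0 T s /\ C1 T s,
      C1 T temperature &
      (forall i j, has_cont_dx T j (stress i j)) /\
      (forall j, has_cont_dx T j (heat_flux j))].

(* e = c_v theta has no meaning for gamma = 1.  Multiplied by gamma - 1, the
   energy equation becomes in that limit the continuity equation (theta being
   constant), so only mass and momentum are kept when gamma = 1. *)
Definition classical_solution (rho0 : vec3 R -> R) (u0 : vec3 R -> vec3 R)
    (s0 : vec3 R -> R) (sbar T : R) : Prop :=
  [/\ classical_regularity T,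
      forall t x, 0 <= t <= T -> 0 <= rho t x,
      forall t x, 0 < t < T ->
        [/\ mass_eq t x, momentum_eq t x & gamma g != 1 -> energy_eq t x],
      forall x, [/\ rho 0 x = rho0 x, u 0 x = u0 x & s 0 x = s0 x] &
      forall t, 0 <= t <= T ->
        [/\ tends_at_infinity (rho t) 0,
            forall i, tends_at_infinity (vel i t) 0 &
            tends_at_infinity (s t) sbar]].

End State.

Definition mass (R : realType) (rho : vec3 R -> R) : \bar R := integral3 rho.

Definition momentum (R : realType) (rho : vec3 R -> R)
    (u : vec3 R -> vec3 R) (i : 'I_3) : \bar R :=
  integral3 (fun x => rho x * u x ord0 i).

Definition momentum_vec (R : realType) (rho : vec3 R -> R)
    (u : vec3 R -> vec3 R) : vec3 R :=
  \row_(i < 3) fine (momentum rho u i).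

Definition kinetic_energy (R : realType) (rho : vec3 R -> R)
    (u : vec3 R -> vec3 R) : \bar R :=
  (2^-1%:E * integral3 (fun x => rho x * enorm (u x) ^+ 2)%R)%E.

Definition in_D (R : realType) (g : gas R) (rho0 : vec3 R -> R)
    (u0 : vec3 R -> vec3 R) (s0 : vec3 R -> R) (sbar T : R)
    (rho : R -> vec3 R -> R) (u : R -> vec3 R -> vec3 R)
    (s : R -> vec3 R -> R) : Prop :=
  [/\ classical_solution g rho u s rho0 u0 s0 sbar T,
      [/\ in_Linfty T (fun t => mass (rho t)),
          forall i, in_Linfty T (fun t => momentum (rho t) (u t) i) &
          in_Linfty T (fun t => kinetic_energy (rho t) (u t))],
      conserved T (fun t => mass (rho t)) &
      forall i, conserved T (fun t => momentum (rho t) (u t) i)].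

Definition in_D_infty (R : realType) (g : gas R) (rho0 : vec3 R -> R)
    (u0 : vec3 R -> vec3 R) (s0 : vec3 R -> R) (sbar : R)
    (rho : R -> vec3 R -> R) (u : R -> vec3 R -> vec3 R)
    (s : R -> vec3 R -> R) : Prop :=
  forall T, 0 < T -> in_D g rho0 u0 s0 sbar T rho u s.

(* Main.v *)
(* Mass and momentum are conserved, and |P_i(t)| <= |u(t)|_oo m(t) because
   rho >= 0.  A component P_i(0) <> 0 thus bounds |u(t)|_oo from below by the
   positive constant |P_i(0)| / m(0) for all t > 0. *)
Require Import Defs.
From mathcomp Require Import all_boot all_order all_algebra.
From mathcomp Require Import all_classical all_reals all_analysis.
From mathcomp Require Import measurable_realfun ess_sup_inf.

Import Order.TTheory GRing.Theory Num.Theory.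
Import numFieldNormedType.Exports.

Local Open Scope classical_set_scope.
Local Open Scope ring_scope.

(** Balls of [vec3 R] are cubes, so the preimage of an open set is a countable union of boxes with
    rational centres and radii [n.+1%:R^-1], and such boxes lie in the product sigma-algebra. *)
Lemma measurable_point3_open (R : realType) (W : set (vec3 R)) :
  open W -> measurable (@point3 R @^-1` W).
Proof.
move=> oW.
pose box (k : rat * rat * rat * nat) :=
  let: (q1, q2, q3, n) := k in
  (ball (ratr q1 : R) n.+1%:R^-1 `*` ball (ratr q2 : R) n.+1%:R^-1)
    `*` ball (ratr q3 : R) n.+1%:R^-1.
have -> : @point3 R @^-1` W =
    \bigcup_k (if `[< box k `<=` @point3 R @^-1` W >] then box k else set0).
  apply/seteqP; split => [[[x y] z] Wp|p [k _]]; last by case: asboolP => //; apply.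
  have /nbhs_ballP[e /= e0 eW] : nbhs (point3 (x, y, z)) W by exact: open_nbhs_nbhs.
  (* A radius below [e / 2] keeps every point of a box containing [(x, y, z)] within [e] of it, the
     rational centre serving as midpoint in the triangle inequality. *)
  have e20 : 0 < e / 2 by rewrite divr_gt0.
  have [n _ /(_ n (leqnn n)) ne] := near_infty_natSinv_lt (PosNum e20).
  have n0 : 0 < n.+1%:R^-1 :> R by rewrite invr_gt0.
  have ratb t : exists q : rat, ball t n.+1%:R^-1 (ratr q : R).
    have tt : ball t n.+1%:R^-1 !=set0 by exists t; exact: ballxx.
    have [z0 [tq [q _ eq_q]]] := dense_rat tt (@ball_open R R^o t n.+1%:R^-1).
    by exists q; rewrite eq_q.
  have [q1 Hq1] := ratb x; have [q2 Hq2] := ratb y; have [q3 Hq3] := ratb z.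
  exists (q1, q2, q3, n) => //.
  case: asboolP => [_|]; first by split; [split|]; exact: ball_sym.
  case=> -[[x' y'] z'] [[/= Hx Hy] Hz]; apply: eW.
  have tri a q b : ball a n.+1%:R^-1 q -> ball q n.+1%:R^-1 b -> @ball _ R a e b.
    move=> aq qb; apply: le_ball (ball_triangle aq qb).
    by rewrite (splitr e) lerD// ltW.
  split=> // i j; rewrite !mxE.
  case: j => -[|[|[|//]]] /= _; [exact: tri Hx|exact: tri Hy|exact: tri Hz].
apply: countable_bigcupT_measurable => [|k]; first exact: countableP.
case: asboolP => // _; case: k => [[[q1 q2] q3] n].
by apply: measurableX; [apply: measurableX|]; exact: measurable_ball.
Qed.

Lemma measurable_continuous_point3 (R : realType) (f : vec3 R -> R) :
  continuous f -> measurable_fun setT (f \o @point3 R).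
Proof.
move=> cf; apply: (measurability _ (RGenOpens.measurableE R)).
move=> _ [_ [a [b ->] <-]]; rewrite setTI comp_preimage.
apply: measurable_point3_open.
by move/continuousP: cf; apply; exact: interval_open.
Qed.

(** The map [y => (t, y)] stays inside the closed strip, even for [t = 0] or [t = T], so continuity
    relative to the strip becomes plain continuity in space. *)
Lemma C0_slice_continuous (R : realType) (T t : R) (f : R -> vec3 R -> R) :
  C0 T f -> 0 <= t <= T -> continuous (f t).
Proof.
move=> /subspace_continuousP cf tT x.
have := cf (t, x); rewrite /= in_itv/= => /(_ (conj tT I)) cfx.
have ctx : (fun y : vec3 R => (t, y)) @ x --> (t, x).
  by apply: (@cvg_pair _ _ _ (nbhs x) (nbhs t) (nbhs x)); [exact: cvg_cst|exact: cvg_id].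
have wtx : (fun y : vec3 R => (t, y)) @ x -->
    within (`[0, T] `*` [set: vec3 R]) (nbhs (t, x)).
  move=> A /ctx wA; change (\forall y \near x, A (t, y)).
  have {}wA : \forall y \near x, (`[0, T] `*` setT) (t, y) -> A (t, y) := wA.
  apply: filterS wA => y; apply.
  by split => //=; rewrite in_itv.
exact: (cvg_comp _ _ wtx cfx).
Qed.

(** Mean value theorem on [[0, t]]: the relative derivative is a genuine one at interior points, and
    at the end points it still yields the required continuity. *)
Lemma is_deriv_within_0_cst (R : realType) (T : R) (f : R -> R) :
  (forall t, 0 <= t <= T -> is_deriv_within T f t 0) ->
  forall t, 0 < t <= T -> f t = f 0.
Proof.
move=> df t /andP[t0 tT].
have slope (x e : R) : 0 <= x <= T -> 0 < e -> \forall s \near x,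
    s != x -> 0 <= s <= T -> `|(f s - f x) / (s - x)| < e.
  move=> xT e0; have /cvgrPdist_lt/(_ e e0) := df x xT.
  rewrite !near_withinE /=; apply: filterS => s /= H sx sT; rewrite -normrN -sub0r; exact: H.
have [||c _] := @MVT R f (fun=> 0) 0 t t0; last first.
- by rewrite mul0r => /eqP; rewrite subr_eq0 => /eqP.
- apply/subspace_continuousP => x /=; rewrite in_itv/= => /andP[x0 xt].
  have xT : 0 <= x <= T by rewrite x0 (le_trans xt).
  apply/cvgrPdist_lt => e e0; near=> s.
  have [->|sx] := eqVneq s x; first by rewrite subrr normr0.
  have sT : 0 <= s <= T.
    have : s \in `[0, t] by near: s; exact: withinT.
    by rewrite in_itv/= => /andP[-> /le_trans ->].
  have dsx : `|s - x| < e.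
    near: s; apply: cvg_within; rewrite /=; apply: filterS (nbhsx_ballx x e e0) => y.
    by rewrite /ball /= distrC.
  (* Any fixed bound on the slope would do; with 1, [f] moves by at most [|s - x| < e]. *)
  have sl : `|(f s - f x) / (s - x)| < 1.
    move: sx sT; near: s; apply: cvg_within; exact: slope.
  rewrite distrC -[f s - f x](divfK (_ : s - x != 0)) ?subr_eq0// normrM.
  apply: le_lt_trans dsx; rewrite -[leRHS]mul1r ler_wpM2r// ltW//.
- move=> x; rewrite in_itv/= => /andP[x0 xt].
  have xT : x < T by exact: lt_le_trans xt tT.
  have D : (fun h => h^-1 *: ((f \o shift x) (h *: (1 : R)) - f x)) @ 0^' --> (0 : R).
    apply/cvgrPdist_lt => e e0.
    (* Since [0 < x < T], all nearby [s] lie in [[0, T]] and the restriction to that interval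
       disappears. *)
    have : \forall s \near x, s != x -> `|(f s - f x) / (s - x)| < e.
      have xT' : 0 <= x <= T by rewrite !ltW.
      apply: filterS3 (slope x e xT' e0) (lt_le_nbhsr x0) (lt_le_nbhsl xT).
      by move=> s sl s0 sT sx; apply: sl => //; rewrite s0.
    rewrite nbhs0P near_withinE; apply: filterS => h /= + h0.
    rewrite -subr_eq0 [x + h]addrC addrK sub0r normrN => /(_ h0).
    by rewrite /GRing.scale /= mulr1 mulrC.
  by apply: DeriveDef; [apply/cvg_ex; exists 0|exact/cvg_lim].
Unshelve. all: by end_near.
Qed.

Lemma Linfty_norm3_le_ae (R : realType) (v : vec3 R -> vec3 R) (e : R) :
  (Linfty_norm3 v <= e%:E)%E ->
  \forall p \ae (@leb3 R), enorm (v (point3 p)) <= e.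
Proof.
rewrite /Linfty_norm3 unlock.
(* [Lnorm] is 0 by convention on a null space, where any property holds a.e. *)
case: ifPn => [_ /ess_supP|].
  by apply: filterS => p /=; rewrite lee_fin; apply: le_trans; exact: ler_norm.
rewrite -leNgt => leb0 _; exists setT; split => //.
by apply/eqP; rewrite eq_le leb0 measure_ge0.
Qed.

Lemma normr_coord_le_enorm (R : realType) (v : vec3 R) i : `|v ord0 i| <= enorm v.
Proof.
rewrite /enorm -sqrtr_sqr ler_wsqrtr// (bigD1 i)//= lerDl.
by apply: sumr_ge0 => j _; exact: sqr_ge0.
Qed.

(** Integrate the a.e. bound [|rho * u_i| <= e * rho]; continuity serves to make the integrands
    measurable. *)
Lemma momentum_le_mass (R : realType) (rho : vec3 R -> R) (u : vec3 R -> vec3 R)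
    (e : R) (i : 'I_3) :
  continuous rho -> (forall x, 0 <= rho x) ->
  continuous (fun x => u x ord0 i) -> 0 <= e ->
  (Linfty_norm3 u <= e%:E)%E ->
  (`|momentum rho u i| <= e%:E * mass rho)%E.
Proof.
move=> crho rho0 cu e0 /Linfty_norm3_le_ae ue.
have mrho := measurable_continuous_point3 _ _ crho.
have mu := measurable_continuous_point3 _ _ cu.
have mrhou : measurable_fun setT
    (fun p => (rho (point3 p) * u (point3 p) ord0 i)%:E : \bar R).
  by apply/measurable_EFinP; exact: measurable_funM mrho mu.
rewrite /momentum /mass /integral3 -ge0_integralZl//; last 2 first.
- by apply/measurable_EFinP.
- by move=> p _; rewrite lee_fin.
apply: (le_trans (le_abse_integral _ _ mrhou)) => //.
apply: ae_ge0_le_integral => //.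
- exact: measurableT_comp mrhou.
- by move=> p _; rewrite mule_ge0 ?lee_fin.
- by apply: measurable_funeM; apply/measurable_EFinP.
apply: filterS ue => p ue _.
rewrite abse_EFin -EFinM lee_fin normrM ger0_norm// mulrC ler_wpM2r//.
exact: le_trans (normr_coord_le_enorm _ _ _) ue.
Qed.

Theorem theorem1p2 (R : realType) (g : gas R)
    (rho0 : vec3 R -> R) (u0 : vec3 R -> vec3 R) (s0 : vec3 R -> R) (sbar : R)
    (A_gt0 : 0 < gasA g) (R_gt0 : 0 < gasR g)
    (gamma_ge1 : 1 <= gamma g)
    (mu_ge0 : forall r th : R, 0 < r -> 0 < th -> 0 <= mu g r th)
    (bulk_ge0 : forall r th : R, 0 < r -> 0 < th ->
       0 <= 2 * mu g r th + 3 * lambda g r th)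
    (kappa_ge0 : forall r th : R, 0 < r -> 0 < th -> 0 <= kappa g r th)
    (rho0_gt0 : forall x, 0 < rho0 x)
    (mass0_gt0 : (0 < mass rho0)%E)
    (momentum0_gt0 : 0 < enorm (momentum_vec rho0 u0)) :
  ~ exists (rho : R -> vec3 R -> R) (u : R -> vec3 R -> vec3 R)
           (s : R -> vec3 R -> R),
      in_D_infty g rho0 u0 s0 sbar rho u s /\
      limf_esup (fun t : R => Linfty_norm3 (u t)) (pinfty_nbhs R) = 0%E.
Proof.
move=> [rho [u [s [solD ulim]]]].
have [i Pi0] : exists i, fine (momentum rho0 u0 i) != 0.
  apply/existsP; move: momentum0_gt0; apply: contraTT => /existsPn P0.
  rewrite -leNgt /enorm big1 ?sqrtr0// => i _.
  by move: (P0 i); rewrite negbK mxE => /eqP ->; rewrite expr0n.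
have rho0E : rho 0 = rho0.
  by have [[_ _ _ init _] _ _ _] := solD 1 ltr01; apply/funext => x; have [] := init x.
have u0E : u 0 = u0.
  by have [[_ _ _ init _] _ _ _] := solD 1 ltr01; apply/funext => x; have [] := init x.
(* Finiteness is part of [conserved], read here at time 0 on the interval [[0, 1]]. *)
have m_fin : mass rho0 \is a fin_num.
  by have [_ _ + _] := solD 1 ltr01; move=> /(_ 0); rewrite lexx ler01 rho0E => -[].
have m_gt0 : 0 < fine (mass rho0) by rewrite fine_gt0// mass0_gt0 ltey_eq m_fin.
pose c := `|fine (momentum rho0 u0 i)|.
have c_gt0 : 0 < c by rewrite normr_gt0.
(* Half of the lower bound [c / m(0)] on the velocity, so that [e * m(0) = c / 2 < c]. *)
pose e := c / (2 * fine (mass rho0)).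
have e_gt0 : 0 < e by rewrite divr_gt0// mulr_gt0.
have : (limf_esup (fun t : R => Linfty_norm3 (u t)) (pinfty_nbhs R) < e%:E)%E.
  by rewrite ulim lte_fin.
(* The limsup is an infimum of suprema over neighbourhoods of [+oo]: some [V] containing all times
   beyond [M] has supremum below [e]. *)
move=> /ereal_inf_lt[_ [V [M [_ MV]] <-] supV].
(* A time beyond [M], and positive so that the solution lies in [D(t)]; below, [t] is also the end
   point of the time interval. *)
pose t := Num.max M 0 + 1.
have t_gt0 : 0 < t by rewrite ltr_wpDl// le_max lexx orbT.
have tT : 0 < t <= t by rewrite t_gt0 lexx.
have tT' : 0 <= t <= t by rewrite ltW/=.
have ut : (Linfty_norm3 (u t) <= e%:E)%E.
  apply/ltW/(le_lt_trans _ supV)/ereal_sup_ubound; exists t => //.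
  by apply: MV; rewrite ltr_pwDr// le_max lexx.
have [[reg rho_ge0 _ _ _] _ dm dP] := solD t t_gt0.
have [[crho _] /(_ i)[cu _] _ _ _] := reg.
(* [conserved] differentiates [fine \o f]; finiteness at both times lifts the equality back to
   extended reals. *)
have cst (f : R -> \bar R) : conserved t f -> f t = f 0.
  move=> df; have [ft _] := df t tT'.
  have [f0 _] : f 0 \is a fin_num /\ is_deriv_within t (fine \o f) 0 0.
    by apply: df; rewrite lexx ltW.
  rewrite -[LHS]fineK// -[RHS]fineK//; congr EFin.
  exact: (is_deriv_within_0_cst _ t (fine \o f) (fun r rT => (df r rT).2)).
have := momentum_le_mass _ (rho t) (u t) e i (C0_slice_continuous _ _ _ _ crho tT')
  (fun x => rho_ge0 t x tT') (C0_slice_continuous _ _ _ _ cu tT') (ltW e_gt0) ut.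
rewrite (cst _ dm) (cst _ (dP i)) rho0E u0E.
have P_fin : momentum rho0 u0 i \is a fin_num.
  by have [] := dP i 0; rewrite ?lexx ?ltW// rho0E u0E.
(* In real numbers the estimate reads [c <= e * m(0)], whose right-hand side is [c / 2]: a
   contradiction. *)
rewrite -(fineK P_fin) -(fineK m_fin) abse_EFin -EFinM lee_fin -/c /e.
rewrite leNgt => /negP; apply.
by rewrite invfM mulrA divfK ?gt_eqF// ltr_pdivrMr// ltr_pMr// ltr1n.
Qed.
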